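(* Let $n\ge 1$, and let $sp(2n,\mathbb{C})\subset sl(2n,\mathbb{C})$ be realized as described in the context, so that its diagonal matrices $\mathrm{diag}(b_1,\dots,b_n,-b_n,\dots,-b_1)$ form a Cartan subalgebra of it. The standard $sp(2n,\mathbb{C})$-compatible parabolic subalgebras of $sl(2n,\mathbb{C})$ are exactly those $\mathfrak{p}_\Pi$, $\Pi\subseteq\Delta=\{\alpha_k-\alpha_{k+1}\mid 1\le k\le 2n-1\}$, such that for all $1\le k\le n-1$ either $\{\alpha_k-\alpha_{k+1},\ \alpha_{2n-k}-\alpha_{2n+1-k}\}\subseteq\Pi$ or $\{\alpha_k-\alpha_{k+1},\ \alpha_{2n-k}-\alpha_{2n+1-k}\}\cap\Pi=\emptyset$.
   Context: Realization of $sp(2n,\mathbb{C})$: it is $DSD^{-1}$, where $S=\left\{\begin{pmatrix}A&B\\C&-A^t\end{pmatrix}\;\middle|\; A\in gl(n,\mathbb{C}),\ B,C\in gl(n,\mathbb{C})\text{ symmetric}\right\}$ and $D$ is whichever of the block diagonal matrices $\mathrm{diag}(I_n,J_n)$, $\mathrm{diag}(I'_n,J_n)$ has determinant $1$; here $I_n$ is the identity, $I'_n=\mathrm{diag}(-1,I_{n-1})$, and $J_n$ is the $n\times n$ anti-diagonal matrix with all anti-diagonal entries $1$. The Cartan subalgebra $\mathfrak{h}$ of $\mathfrak{g}=sl(2n,\mathbb{C})$ is the set of trace-zero diagonal matrices, $\alpha_k(\mathrm{diag}(a_1,\dots,a_{2n}))=a_k$, and $\Delta$ is the simple system $\{\alpha_k-\alpha_{k+1}\mid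 1\le k\le 2n-1\}$ with positive system $\Phi^+$. For $\Pi\subseteq\Delta$, the standard parabolic subalgebra is $\mathfrak{p}_\Pi=\mathfrak{h}+\sum_{\alpha\in\Phi^+}\mathfrak{g}_\alpha+\sum_{\alpha\in\mathbb{N}\Pi\cap\Phi^+}\mathfrak{g}_{-\alpha}$, where $\mathfrak{g}_\alpha$ is the root space of $\alpha$ and $\mathbb{N}\Pi$ denotes the non-negative integer combinations of elements of $\Pi$. A semisimple element $H\in\mathfrak{g}$ is hyperbolic if all eigenvalues of $\mathrm{ad}(H)$ on $\mathfrak{g}$ are real; for such $H$, $\mathfrak{p}(H)$ is the sum of the eigenspaces of $\mathrm{ad}(H)$ with eigenvalues $\ge 0$, a parabolic subalgebra of $\mathfrak{g}$. For a reductive subalgebra $\mathfrak{g}'$ of $\mathfrak{g}$, a parabolic subalgebra $\mathfrak{p}$ of $\mathfrak{g}$ is $\mathfrak{g}'$-compatible if there exists $H\in\mathfrak{g}'$, hyperbolic as an element of $\mathfrak{g}$, with $\mathfrak{p}=\mathfrak{p}(H)$. *)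

(* Defs.v *)
From HB Require Import structures.
From mathcomp Require Import all_boot all_order all_algebra.
From mathcomp Require Import classical_sets reals.
From mathcomp Require Import complex.

Set Implicit Arguments.
Unset Strict Implicit.
Unset Printing Implicit Defensive.

Import Order.TTheory GRing.Theory Num.Theory.
Local Open Scope classical_set_scope.
Local Open Scope ring_scope.

(* Finite sums, with repetitions, of elements of A.  For a set A of vectors
   this is the set of non-negative integer combinations of A; for a union A of
   linear subspaces it is their sum as subspaces. *)
Definition nspan (V : nmodType) (A : set V) : set V :=
  [set v | exists s : seq V, [set` s] `<=` A /\ v = \sum_(x <- s) x].

Section SpecialLinear.
Variables (R : realType) (N : nat).
Local Notation C := R[i].

Definition sl : {vspace 'M[C]_N} :=
  lker (linfun (@mxtrace C N : 'M[C]_N -> C^o)).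

Lemma mem_sl (X : 'M[C]_N) : (X \in sl) = (\tr X == 0).
Proof. by rewrite memv_ker lfunE. Qed.

Definition ad (H : 'M[C]_N) : 'End('M[C]_N) :=
  (linfun (mulmx H) - linfun (mulmxr H))%R.

Lemma adE (H X : 'M[C]_N) : ad H X = H *m X - X *m H.
Proof. by rewrite /ad add_lfunE opp_lfunE !lfunE. Qed.

Definition cartan : {vspace 'M[C]_N} :=
  (sl :&: limg (linfun (@diag_mx C N)))%VS.

Lemma mem_cartan (X : 'M[C]_N) :
  (X \in cartan) = (\tr X == 0) && is_diag_mx X.
Proof.
rewrite memv_cap mem_sl; congr andb.
apply/memv_imgP/diag_mxP => [[d _ ->]|[d ->]]; exists d; rewrite ?memvf ?lfunE//.
Qed.

Definition weight := 'Hom(subvs_of cartan, C^o).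

(* The functional diag(a_1, ..., a_N) |-> a_k.  The index k counts from 1 as in
   the usual notation, whereas matrix entries are indexed from 0; the sum has
   at most one term, and alpha k = 0 unless 1 <= k <= N. *)
Definition alpha (k : nat) : weight :=
  linfun (fun H : subvs_of cartan =>
            \sum_(i < N | i.+1 == k) vsval H i i : C^o).

Lemma alphaE (k : nat) (H : subvs_of cartan) :
  alpha k H = \sum_(i < N | i.+1 == k) vsval H i i.
Proof.
pose f (H : subvs_of cartan) : C^o := \sum_(i < N | i.+1 == k) vsval H i i.
have f_lin : linear f.
  move=> c H1 H2; rewrite /f scaler_sumr -big_split /=.
  apply: eq_bigr => i _.
  have := linearP (@vsval _ _ cartan) c H1 H2.
  by move=> /matrixP/(_ i i); rewrite !mxE.
pose fL := GRing.isLinear.Build _ _ _ _ f f_lin.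
pose F : {linear subvs_of cartan -> C^o} := HB.pack f fL.
exact: (lfunE F).
Qed.

Definition simple_roots : set weight :=
  [set alpha k - alpha k.+1 | k in [set k | (1 <= k <= N.-1)%N]].

Definition root_space (a : weight) : set 'M[C]_N :=
  [set X | X \in sl /\
           forall H : subvs_of cartan, ad (vsval H) X = (a H : C) *: X].

Definition root_system : set weight :=
  [set a | a != 0 /\ exists2 X, root_space a X & X != 0].

Definition positive_roots : set weight := root_system `&` nspan simple_roots.

Definition standard_parabolic (Pi : set weight) : set 'M[C]_N :=
  nspan ([set` cartan]
         `|` \bigcup_(a in positive_roots) root_space a
         `|` \bigcup_(a in nspan Pi `&` positive_roots) root_space (- a)).

(* ad H maps sl to itself when H is in sl, so this is an eigenspace of the
   restriction of ad H to sl. *)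
Definition ad_eigenspace (H : 'M[C]_N) (c : C) : {vspace 'M[C]_N} :=
  (passmx.leigenspace (ad H) c :&: sl)%VS.

Definition ad_semisimple (H : 'M[C]_N) : Prop :=
  nspan (\bigcup_c [set` ad_eigenspace H c]) = [set` sl].

Definition hyperbolic (H : 'M[C]_N) : Prop :=
  [/\ H \in sl, ad_semisimple H
    & forall c : C, ad_eigenspace H c != 0%VS -> c \is Num.real].

(* In the order of R[i], 0 <= c says that c is real and non-negative. *)
Definition parabolic_of (H : 'M[C]_N) : set 'M[C]_N :=
  nspan (\bigcup_(c in [set c : C | 0 <= c]) [set` ad_eigenspace H c]).

Definition compatible (g' p : set 'M[C]_N) : Prop :=
  exists H, [/\ g' H, hyperbolic H & p = parabolic_of H].

(* A nilpotent Lie subalgebra of g that is its own normalizer in g; nilpotency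
   is the vanishing of all iterated brackets of some length. *)
Definition is_cartan_subalgebra (g t : set 'M[C]_N) : Prop :=
  [/\ t `<=` g,
      t 0 /\ (forall c X Y, t X -> t Y -> t (c *: X + Y)),
      forall X Y, t X -> t Y -> t (ad X Y),
      exists m, forall X (s : m.-tuple 'M[C]_N),
        t X -> [set` s] `<=` t -> foldl (fun Y Z => ad Z Y) X s = 0
    & forall X, g X -> (forall Y, t Y -> t (ad X Y)) -> t X].

End SpecialLinear.

Arguments sl R N : clear implicits.
Arguments cartan R N : clear implicits.
Arguments alpha R N k : clear implicits.
Arguments simple_roots R N : clear implicits.
Arguments root_system R N : clear implicits.
Arguments positive_roots R N : clear implicits.

Section Symplectic.
Variables (R : realType) (n : nat).
Local Notation C := R[i].

Definition antidiag_mx : 'M[C]_n := \matrix_(i, j) (j == rev_ord i)%:R.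

Definition signed_id_mx : 'M[C]_n :=
  diag_mx (\row_(i < n) if i == 0 :> nat then -1 else 1).

Definition sp_conj_mx : 'M[C]_(n + n) :=
  let D := block_mx 1%:M 0 0 antidiag_mx in
  if \det D == 1 then D else block_mx signed_id_mx 0 0 antidiag_mx.

Definition sp_block : set 'M[C]_(n + n) :=
  [set M | exists A B C : 'M[R[i]]_n,
     [/\ B^T = B, C^T = C & M = block_mx A B C (- A^T)]].

Definition sp : set 'M[C]_(n + n) :=
  [set sp_conj_mx *m M *m invmx sp_conj_mx | M in sp_block].

Lemma antidiag_mxK : antidiag_mx *m antidiag_mx = 1%:M.
Proof.
apply/matrixP => i j; rewrite !mxE (bigD1 (rev_ord i)) //= !mxE eqxx mul1r.
rewrite rev_ordK big1 ?addr0; first by rewrite eq_sym.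
by move=> k /negPf ki; rewrite !mxE ki mul0r.
Qed.

Lemma signed_id_mxK : signed_id_mx *m signed_id_mx = 1%:M.
Proof.
rewrite mulmx_diag -diag_const_mx; congr diag_mx; apply/rowP => i.
by rewrite !mxE; case: ifP => _; rewrite ?mulrNN mulr1.
Qed.

Lemma sp_conj_mxE : exists d : 'rV[C]_n,
  diag_mx d *m diag_mx d = 1%:M
  /\ sp_conj_mx = block_mx (diag_mx d) 0 0 antidiag_mx.
Proof.
rewrite /sp_conj_mx; case: ifP => _.
  by exists (const_mx 1); rewrite diag_const_mx mul1mx.
by eexists; split; [exact: signed_id_mxK|].
Qed.

Lemma sp_conj_mxK : sp_conj_mx *m sp_conj_mx = 1%:M.
Proof.
have [d [dd ->]] := sp_conj_mxE.
rewrite mulmx_block !mulmx0 !mul0mx !addr0 !add0r antidiag_mxK dd.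
by rewrite -scalar_mx_block.
Qed.

Lemma invmx_sp_conj_mx : invmx sp_conj_mx = sp_conj_mx.
Proof.
have [Du _] := mulmx1_unit sp_conj_mxK.
by rewrite -[RHS](mulKmx Du) sp_conj_mxK mulmx1.
Qed.

Lemma antidiag_conj (b : 'rV[C]_n) :
  antidiag_mx *m diag_mx b *m antidiag_mx = diag_mx (\row_i b 0 (rev_ord i)).
Proof.
apply/matrixP => i j; rewrite mul_mx_diag !mxE.
rewrite (bigD1 (rev_ord i)) //= !mxE eqxx mul1r rev_ordK [j == i]eq_sym.
rewrite big1 ?addr0 ?mulr_natr // => k /negPf ki.
by rewrite !mxE ki !mul0r.
Qed.

Definition sp_cartan : set 'M[C]_(n + n) :=
  [set M | exists b : 'rV[C]_n,
     M = diag_mx (row_mx b (- \row_i b 0 (rev_ord i)))].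

Lemma sp_diagE : sp `&` [set M | is_diag_mx M] = sp_cartan.
Proof.
have [d [dd DE]] := sp_conj_mxE.
have DMD (A B A' B' : 'M[C]_n) :
    sp_conj_mx *m block_mx A B A' B' *m invmx sp_conj_mx =
    block_mx (diag_mx d *m A *m diag_mx d) (diag_mx d *m B *m antidiag_mx)
             (antidiag_mx *m A' *m diag_mx d)
             (antidiag_mx *m B' *m antidiag_mx).
  rewrite invmx_sp_conj_mx DE !mulmx_block.
  by rewrite !(mulmx0, mul0mx, addr0, add0r).
have dbd (b : 'rV[C]_n) : diag_mx d *m diag_mx b *m diag_mx d = diag_mx b.
  by rewrite diag_mxC -mulmxA dd mulmx1.
have JbJ (b : 'rV[C]_n) : antidiag_mx *m - (diag_mx b)^T *m antidiag_mx =
    diag_mx (- \row_i b 0 (rev_ord i)).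
  by rewrite tr_diag_mx mulmxN mulNmx antidiag_conj raddfN.
apply/seteqP; split => [M [[_ [A [B [A' [_ _ ->]]]] <-]]|M [b ->]] /=; last first.
  split; last exact: diag_mx_is_diag.
  exists (block_mx (diag_mx b) 0 0 (- (diag_mx b)^T)).
    by exists (diag_mx b), 0, 0; rewrite !trmx0.
  rewrite DMD dbd JbJ !mulmx0 !mul0mx.
  by rewrite diag_mx_row.
rewrite DMD => diagM.
have /is_diag_mxP Mdiag := diagM.
have ur : diag_mx d *m B *m antidiag_mx = 0.
  apply/matrixP => i j; have := Mdiag (lshift n i) (rshift n j).
  rewrite block_mxEur => ->; first by rewrite mxE.
  by rewrite /= neq_ltn (leq_trans (ltn_ord i)) ?leq_addr.
have dl : antidiag_mx *m A' *m diag_mx d = 0.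
  apply/matrixP => i j; have := Mdiag (rshift n i) (lshift n j).
  rewrite block_mxEdl => ->; first by rewrite mxE.
  by rewrite /= neq_ltn orbC (leq_trans (ltn_ord j)) ?leq_addr.
have /diag_mxP[b bE] : is_diag_mx (diag_mx d *m A *m diag_mx d).
  apply/is_diag_mxP => i j ij; have := Mdiag (lshift n i) (lshift n j).
  by rewrite block_mxEul; apply.
have AE : A = diag_mx b.
  by rewrite -(dbd b) -bE !mulmxA dd mul1mx -mulmxA dd mulmx1.
exists b; rewrite ur dl bE AE JbJ.
by rewrite diag_mx_row.
Qed.

Lemma sp_cartan_is_cartan : is_cartan_subalgebra sp sp_cartan.
Proof.
have tsp : sp_cartan `<=` sp by rewrite -sp_diagE => X [].
have ad_diag0 (X Y : 'M[C]_(n + n)) : sp_cartan X -> sp_cartan Y -> ad X Y = 0.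
  by move=> [b ->] [c ->]; rewrite adE diag_mxC subrr.
have t0 : sp_cartan 0.
  exists 0; apply/matrixP => i j; rewrite !mxE.
  by case: splitP => k _; rewrite !mxE ?oppr0 mul0rn.
split => //.
- split=> // c _ _ [a ->] [b ->]; exists (c *: a + b).
  rewrite -linearZ -raddfD /=; congr diag_mx; apply/rowP => i; rewrite !mxE.
  by case: splitP => k _; rewrite !mxE // opprD mulrN.
- by move=> X Y tX tY; rewrite ad_diag0.
- exists 1%N => X s tX; case/tupleP: s => Y s; rewrite tuple0 /= => st.
  by rewrite ad_diag0 //; apply: st; rewrite /= mem_head.
move=> X spX normX; rewrite -sp_diagE; split=> //=.
pose b : 'rV[C]_n := \row_i i.+1%:R.
pose h := row_mx b (- \row_i b 0 (rev_ord i)).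
have h_inj : injective (h 0).
  move=> i j; rewrite -(splitK i) -(splitK j).
  case: (split i) => k; case: (split j) => l;
    rewrite /= ?row_mxEl ?row_mxEr !mxE => hkl.
  - by congr lshift; apply/val_inj/eqP; rewrite -eqSS -(eqr_nat C) hkl.
  - by have := ltr0Sn C k; rewrite hkl oppr_gt0 lt_gtF ?ltr0Sn.
  - by have := ltr0Sn C l; rewrite -hkl oppr_gt0 lt_gtF ?ltr0Sn.
  - congr rshift; apply/rev_ord_inj/val_inj/eqP.
    by rewrite -eqSS -(eqr_nat C); apply/eqP/oppr_inj.
have : is_diag_mx (ad X (diag_mx h)).
  have [c ->] := normX (diag_mx h) (ex_intro _ b erefl).
  exact: diag_mx_is_diag.
move=> /is_diag_mxP Xd; apply/is_diag_mxP => i j ij.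
have adh (d : 'rV[C]_(n + n)) :
    ad X (diag_mx d) i j = X i j * (d 0 j - d 0 i).
  by rewrite adE mul_mx_diag mul_diag_mx !mxE mulrBr [d 0 i * _]mulrC.
have := Xd _ _ ij; rewrite adh => /eqP; rewrite mulf_eq0 => /orP[/eqP //|].
by rewrite subr_eq0 => /eqP/h_inj ji; rewrite ji eqxx in ij.
Qed.

End Symplectic.

Arguments sp_block R n : clear implicits.
Arguments sp R n : clear implicits.
Arguments sp_cartan R n : clear implicits.

(* Main.v *)
Require Import Defs.
From mathcomp Require Import all_boot all_order all_algebra.
From mathcomp Require Import boolp classical_sets reals.
From mathcomp Require Import complex.

Set Implicit Arguments.
Unset Strict Implicit.
Unset Printing Implicit Defensive.

Import Order.TTheory GRing.Theory Num.Theory.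
Local Open Scope classical_set_scope.
Local Open Scope ring_scope.

(** Two facts carry the proof.

    Symmetry is necessary.  Let [W] be the matrix, with [W *m W = - 1%:M], of
    the symplectic form preserved by [sp R n]; it is monomial and supported on
    the antidiagonal.  The map [X |-> W *m X^T *m W] is an involution of
    sl(2n) that respects brackets ([sp_invol_ad]) and fixes [sp R n] pointwise
    ([sp_invol_fix]).  If [H] lies in [sp R n], the involution therefore
    preserves every eigenspace of [ad H], hence [parabolic_of H]
    ([parabolic_of_invol]), whether or not [H] is diagonal.  On entries, it
    moves a nonzero (i, j) entry to position (rev j, rev i)
    ([sp_invol_entry]), so on simple roots it exchanges k with 2n - k.  Since
    [Pi] can be read off from the subdiagonal entries that occur in
    [standard_parabolic Pi] ([standard_parabolic_simple]), [Pi] is symmetric.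

    Symmetry is sufficient.  If [Pi] is symmetric, choose a real diagonal [H]
    on which the simple roots in [Pi] vanish and the others take the value 2.
    The entries of the [ladder] below do this, and the symmetry of [Pi] makes
    them antisymmetric under reversal, which is what membership of the Cartan
    subalgebra of [sp R n] means.  Then [parabolic_of H] and
    [standard_parabolic Pi] are both the space of traceless matrices whose
    nonzero entries (i, j) satisfy [H j j <= H i i] ([parabolic_of_diag],
    [standard_parabolic_ladder]). *)

(** * Additive span of a set *)

Section NSpan.
Variable V : nmodType.

Lemma nspan_min (A P : set V) : P 0 -> (forall x y, P x -> P y -> P (x + y)) ->
  A `<=` P -> nspan A `<=` P.
Proof.
move=> P0 PD AP _ [s [sA ->]]; elim: s sA => [|x s IH] sA; first by rewrite big_nil.
rewrite big_cons; apply: PD; first by apply/AP/sA; rewrite /= mem_head.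
by apply: IH => y ys; apply: sA; rewrite /= inE [y \in s]ys orbT.
Qed.

Lemma nspan0 (A : set V) : nspan A 0.
Proof. by exists [::]; rewrite big_nil. Qed.

Lemma nspan_gen (A : set V) : A `<=` nspan A.
Proof.
move=> x Ax; exists [:: x]; rewrite big_seq1; split=> // y /=.
by rewrite inE => /eqP ->.
Qed.

Lemma nspanD (A : set V) x y : nspan A x -> nspan A y -> nspan A (x + y).
Proof.
move=> [s [sA ->]] [t [tA ->]]; exists (s ++ t); rewrite big_cat; split=> // z /=.
by rewrite mem_cat => /orP[/sA|/tA].
Qed.

Lemma nspan_sum (A : set V) (I : Type) (r : seq I) (P : pred I) (F : I -> V) :
  (forall i, P i -> nspan A (F i)) -> nspan A (\sum_(i <- r | P i) F i).
Proof. move=> AF; apply: big_ind => //; [exact: nspan0 | exact: nspanD]. Qed.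

End NSpan.

(** * Roots, weight vectors and matrix entries *)

Section Roots.
Variables (R : realType) (N : nat).
Local Notation C := R[i].
Local Notation alpha := (alpha R N).

Lemma alpha_ord (i : 'I_N) (H : subvs_of (cartan R N)) :
  alpha i.+1 H = vsval H i i.
Proof.
rewrite alphaE (bigD1 i) //= big1 ?addr0 // => j /andP[].
by rewrite eqSS => /eqP/val_inj ->; rewrite eqxx.
Qed.

Lemma cartan_diag (H : subvs_of (cartan R N)) : exists d, vsval H = diag_mx d.
Proof. by have := subvsP H; rewrite mem_cartan => /andP[_ /diag_mxP]. Qed.

Lemma ad_diag (d : 'rV[C]_N) (X : 'M[C]_N) i j :
  ad (diag_mx d) X i j = (d 0 i - d 0 j) * X i j.
Proof. by rewrite adE mul_diag_mx mul_mx_diag !mxE mulrBl [_ * d 0 j]mulrC. Qed.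

(** Evaluating the eigenvector equation at one nonzero entry pins down the
    eigenvalue; this is how every inclusion of a span of root spaces into a
    space of matrices with prescribed zeros is obtained. *)
Lemma root_space_entry (b : weight R N) (X : 'M[C]_N) i j :
  root_space b X -> X i j != 0 -> b = alpha i.+1 - alpha j.+1.
Proof.
move=> [_ bX] Xij; apply/lfunP => H; rewrite add_lfunE opp_lfunE !alpha_ord.
have [d dE] := cartan_diag H.
have /matrixP/(_ i j) := bX H; rewrite dE ad_diag !mxE !eqxx !mulr1n.
by move=> /(mulIf Xij) <-.
Qed.

Lemma root_space_delta (c : C) (i j : 'I_N) : i != j ->
  root_space (alpha i.+1 - alpha j.+1) (c *: delta_mx i j).
Proof.
move=> ij; split.
  rewrite mem_sl mxtraceZ /mxtrace big1 ?mulr0 // => k _; rewrite mxE.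
  by case: eqP => // ->; rewrite (negPf ij).
move=> H; rewrite add_lfunE opp_lfunE !alpha_ord.
have [d ->] := cartan_diag H; apply/matrixP => k l.
rewrite ad_diag !mxE !eqxx !mulr1n.
by case: (k =P i) => [->|_]; case: (l =P j) => [->|_] //=; rewrite ?mulr0.
Qed.

Lemma simple_root_ord (i : nat) : (i.+1 < N)%N ->
  simple_roots R N (alpha i.+1 - alpha i.+2).
Proof. by move=> iN; exists i.+1 => //=; rewrite -ltnS; case: N iN. Qed.

Lemma simple_rootP (a : weight R N) : simple_roots R N a ->
  exists2 i, (i.+1 < N)%N & a = alpha i.+1 - alpha i.+2.
Proof.
move=> [[|i]] //= iN <-; exists i => //; by case: N iN.
Qed.

Lemma nspan_alpha (A : set (weight R N)) (i j : nat) : (i <= j)%N ->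
  (forall k, (i <= k < j)%N -> A (alpha k.+1 - alpha k.+2)) ->
  nspan A (alpha i.+1 - alpha j.+1).
Proof.
move=> ij Ak.
rewrite (_ : _ - _ = \sum_(i <= k < j) (alpha k.+1 - alpha k.+2)).
  by rewrite big_nat; apply: nspan_sum => k kij; apply/nspan_gen/Ak.
rewrite (@telescope_sumr_eq _ _ _ (fun k => - alpha k.+1)) //.
  by rewrite opprK addrC.
by move=> k _; rewrite opprK addrC.
Qed.

Lemma nspan_pattern (P : 'I_N -> 'I_N -> Prop) (A : set 'M[C]_N) :
  let S := [set X | X \in sl R N /\ forall i j, X i j != 0 -> P i j] in
  A `<=` S -> nspan A `<=` S.
Proof.
move=> S AS; apply: nspan_min => // [|X Y [Xsl XP] [Ysl YP]].
  by split=> [|i j]; [exact: mem0v | rewrite mxE eqxx].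
split=> [|i j]; first exact: rpredD.
by rewrite mxE; have [->|/XP] := eqVneq (X i j) 0; rewrite ?add0r // => /YP.
Qed.

Lemma vsval_vsproj_diag (d : 'rV[C]_N) : \sum_i d 0 i = 0 ->
  vsval (vsproj (cartan R N) (diag_mx d)) = diag_mx d.
Proof.
move=> d0; rewrite vsprojK // mem_cartan diag_mx_is_diag andbT mxtrace_diag.
exact/eqP.
Qed.

Lemma diag_part_sum (X : 'M[C]_N) : X \in sl R N -> \sum_i (\row_i X i i) 0 i = 0.
Proof.
by rewrite mem_sl => /eqP trX; rewrite -[RHS]trX; apply: eq_bigr => i _; rewrite mxE.
Qed.

(** A matrix is its diagonal part plus its nonzero off-diagonal entries, and
    these pieces are homogeneous both for roots and for eigenvalues of the
    adjoint action of a diagonal matrix; so this serves the standard parabolic,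
    the parabolic of a diagonal matrix, and semisimplicity alike. *)
Lemma nspan_entries (A : set 'M[C]_N) (X : 'M[C]_N) :
  A (diag_mx (\row_i X i i)) ->
  (forall i j, i != j -> X i j != 0 -> A (X i j *: delta_mx i j)) ->
  nspan A X.
Proof.
move=> Ad Ao.
have -> : X = diag_mx (\row_i X i i) +
    \sum_i \sum_(j | (i != j) && (X i j != 0)) X i j *: delta_mx i j.
  rewrite {1}[X]matrix_sum_delta.
  rewrite (_ : diag_mx _ = \sum_i X i i *: delta_mx i i); last first.
    rewrite diag_mx_sum_delta; apply: eq_bigr => i _.
    by rewrite mxE.
  rewrite -big_split; apply: eq_bigr => i _ /=.
  rewrite (bigD1 i) //=; congr (_ + _).
  rewrite (bigID (fun j => X i j == 0)) /= big1 ?add0r.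
    by apply: eq_bigl => j; rewrite eq_sym.
  by move=> j /andP[_ /eqP ->]; rewrite scale0r.
apply: nspanD; first exact: nspan_gen.
apply: nspan_sum => i _; apply: nspan_sum => j /andP[ij Xij].
by apply/nspan_gen/Ao.
Qed.

(** * Diagonal matrices with prescribed values on the simple roots *)

(** Consecutive entries i - 1, i (counted from 0) differ by 2 or by 0 according
    to [c i], so the simple roots take these values; the signed sum, rather
    than a one-sided one, makes the entries antisymmetric when [c] is invariant
    under k |-> N - k.  When [c] is constantly true this is twice the usual
    grading element, on which all simple roots agree. *)
Definition ladder (c : nat -> bool) : 'rV[C]_N :=
  \row_i \sum_(1 <= k < N) (if (k <= i)%N then - (c k)%:R else (c k)%:R).

Lemma ladderB c (i j : 'I_N) : (i <= j)%N ->
  ladder c 0 i - ladder c 0 j = \sum_(1 <= k < N | (i < k <= j)%N) (c k)%:R *+ 2.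
Proof.
move=> ij; rewrite !mxE -sumrB [RHS]big_mkcond /=; apply: eq_bigr => k _.
case: (leqP k i) => [ki|ik] /=; first by rewrite (leq_trans ki ij) subrr.
by case: leqP => _; rewrite ?subrr // opprK mulr2n.
Qed.

Lemma ladder_succ c (i j : 'I_N) : j = i.+1 :> nat ->
  ladder c 0 i - ladder c 0 j = (c j)%:R *+ 2.
Proof.
move=> ji; rewrite ladderB ?ji //.
rewrite (eq_bigl (fun k => k == i.+1)); last by move=> k; rewrite -eqn_leq eq_sym.
by rewrite big_nat1_eq /= -ji ltn_ord.
Qed.

Lemma ladder_eq c (i j : 'I_N) : (i <= j)%N -> ladder c 0 i <= ladder c 0 j ->
  forall k, (i < k <= j)%N -> c k = false.
Proof.
move=> ij; rewrite -subr_le0 ladderB // => le0 k kij.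
have : \sum_(1 <= k < N | (i < k <= j)%N) (c k)%:R *+ 2 == 0 :> C.
  by rewrite eq_le le0 sumr_ge0 // => l _; rewrite mulrn_wge0.
rewrite psumr_eq0; last by move=> l _; rewrite mulrn_wge0.
move=> /allP/(_ k); rewrite mem_index_iota kij /=.
have /andP[ik kj] := kij.
rewrite (leq_ltn_trans _ ik) ?(leq_ltn_trans kj) // => /(_ isT).
by rewrite mulrn_eq0 /= pnatr_eq0 eqb0 => /negPf.
Qed.

Lemma ladder_real c i : ladder c 0 i \is Num.real.
Proof. by rewrite mxE; apply: rpred_sum => k _; case: ifP; rewrite ?rpredN realn. Qed.

Lemma ladder_rev c : (forall k, (0 < k < N)%N -> c (N - k)%N = c k) ->
  forall i, ladder c 0 (rev_ord i) = - ladder c 0 i.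
Proof.
move=> c_sym i; rewrite !mxE big_nat_rev -sumrN !big_nat; apply: eq_bigr => k kN.
have -> : (1 + N - k.+1 = N - k)%N by rewrite subSS.
rewrite c_sym //.
have -> : (N - k <= rev_ord i)%N = ~~ (k <= i)%N.
  by rewrite /= leq_sub2lE // -ltnNge.
by case: leqP => _ //=; rewrite opprK.
Qed.

Lemma ladder_sum c : (forall k, (0 < k < N)%N -> c (N - k)%N = c k) ->
  \sum_i ladder c 0 i = 0.
Proof.
move=> c_sym; set S := (\sum_i _).
have : S = - S.
  rewrite {1}/S (reindex_inj rev_ord_inj) /= /S -sumrN.
  by apply: eq_bigr => i _; rewrite ladder_rev.
by move/eqP; rewrite -addr_eq0 -mulr2n mulrn_eq0 => /eqP.
Qed.

Definition ladder_cartan c : subvs_of (cartan R N) :=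
  vsproj (cartan R N) (diag_mx (ladder c)).

Lemma alphaB_ladder c (i j : 'I_N) :
  (forall k, (0 < k < N)%N -> c (N - k)%N = c k) ->
  (alpha i.+1 - alpha j.+1) (ladder_cartan c) =
  ladder c 0 i - ladder c 0 j.
Proof.
move=> c_sym; rewrite add_lfunE opp_lfunE !alpha_ord.
by rewrite vsval_vsproj_diag ?ladder_sum // [LHS]/= !mxE !eqxx !mulr1n.
Qed.

Lemma simple_root_ladder c (i : nat) : (i.+1 < N)%N ->
  (forall k, (0 < k < N)%N -> c (N - k)%N = c k) ->
  (alpha i.+1 - alpha i.+2) (ladder_cartan c) =
  (c i.+1)%:R *+ 2.
Proof.
move=> iN c_sym.
by rewrite (alphaB_ladder (Ordinal (ltnW iN)) (Ordinal iN)) // (ladder_succ c).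
Qed.

Lemma simple_root_height (a : weight R N) : simple_roots R N a ->
  a (ladder_cartan xpredT) = 2.
Proof. by move=> /simple_rootP[i iN ->]; rewrite simple_root_ladder. Qed.

(** All simple roots have the same nonzero height, so a simple root that is a
    sum of simple roots is a sum with exactly one term. *)
Lemma simple_in_nspan (Pi : set (weight R N)) a : Pi `<=` simple_roots R N ->
  simple_roots R N a -> nspan Pi a -> Pi a.
Proof.
move=> PiS aS [s [sPi aE]].
have : a (ladder_cartan xpredT) = (size s)%:R *+ 2.
  rewrite aE sum_lfunE big_seq (eq_bigr (fun=> 2)) -?big_seq; last first.
    by move=> x /sPi/PiS/simple_root_height.
  by rewrite big_const_seq count_predT iter_addr_0 -[in RHS]mulrnA mulnC mulrnA.
rewrite simple_root_height // => /eqP; rewrite -mulrnA eqr_nat.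
case: s sPi aE => [|x [|y s]] //= sPi.
by rewrite big_seq1 => -> _; apply: sPi; rewrite /= mem_head.
Qed.

Lemma positive_root_alpha (i j : 'I_N) : (i < j)%N ->
  positive_roots R N (alpha i.+1 - alpha j.+1).
Proof.
move=> ij; have ij' : i != j by rewrite neq_ltn ij.
split; last first.
  apply: nspan_alpha (ltnW ij) _ => k /andP[_ kj]; apply: simple_root_ord.
  exact: leq_ltn_trans kj _.
split.
  apply/eqP => /(congr1 (fun a : weight R N =>
     a (ladder_cartan xpredT))).
  rewrite alphaB_ladder // zero_lfunE => /eqP; rewrite subr_eq0 => /eqP le.
  have := @ladder_eq xpredT i j (ltnW ij).
  by rewrite le lexx => /(_ isT j); rewrite ij leqnn => /(_ isT).
exists (1 *: delta_mx i j); first exact: root_space_delta.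
rewrite scale1r; apply/eqP => /matrixP/(_ i j)/eqP.
by rewrite !mxE !eqxx oner_eq0.
Qed.

Lemma nspan_ge0 (A : set (weight R N)) H : (forall a, A a -> 0 <= a H) ->
  forall b, nspan A b -> 0 <= b H.
Proof.
move=> A0; apply: nspan_min => //=; first by rewrite zero_lfunE.
by move=> x y x0 y0; rewrite add_lfunE addr_ge0.
Qed.

Lemma nspan_eq0 (A : set (weight R N)) H : (forall a, A a -> a H = 0) ->
  forall b, nspan A b -> b H = 0.
Proof.
move=> A0; apply: nspan_min => //=; first by rewrite zero_lfunE.
by move=> x y x0 y0; rewrite add_lfunE x0 y0 addr0.
Qed.

(** Only the root space of [- (alpha i.+1 - alpha j.+1)] has a nonzero (j, i)
    entry.  That root has negative height, so it is not positive, and it can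
    enter the standard parabolic only if the simple root itself is a sum of
    elements of [Pi]. *)
Lemma standard_parabolic_simple (Pi : set (weight R N)) (i j : 'I_N) :
  Pi `<=` simple_roots R N -> j = i.+1 :> nat ->
  Pi (alpha i.+1 - alpha j.+1) <->
  (exists2 X, standard_parabolic Pi X & X j i != 0).
Proof.
move=> PiS ji; have iN : (i.+1 < N)%N by rewrite -ji.
have ij : (i < j)%N by rewrite ji.
split=> [Pia|[X pX Xji]].
  exists (1 *: delta_mx j i); last by rewrite !mxE !eqxx mulr1 oner_eq0.
  apply: nspan_gen; right; exists (alpha i.+1 - alpha j.+1).
    by split; [exact: nspan_gen|exact: positive_root_alpha].
  by rewrite opprB; apply: root_space_delta; rewrite neq_ltn ij orbT.
have aS : simple_roots R N (alpha i.+1 - alpha j.+1).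
  by rewrite ji; apply: simple_root_ord.
apply: contrapT => Pia; move/eqP: Xji; apply.
apply: (nspan_min (P := [set X : 'M[C]_N | X j i = 0])) pX => //=.
- by rewrite mxE.
- by move=> x y /= x0 y0; rewrite mxE x0 y0 addr0.
move=> {}X /= [[|]|].
- rewrite mem_cartan => /andP[_ /is_diag_mxP]; apply.
  by rewrite neq_ltn ij orbT.
- move=> [b [_ bS]] bX; apply/eqP/negPn/negP => /(root_space_entry bX) bE.
  have : 0 <= b (ladder_cartan xpredT).
    by apply: (nspan_ge0 _ bS) => a /simple_root_height ->; apply: ler0n.
  by rewrite bE -opprB opp_lfunE simple_root_height // oppr_ge0 lern0.
- move=> [b [bPi _]] bX; apply/eqP/negPn/negP => /(root_space_entry bX).
  move=> /eqP; rewrite eqr_oppLR opprB => /eqP bE; apply: Pia.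
  by apply: simple_in_nspan => //; rewrite -bE.
Qed.

(** * Parabolic subalgebras of diagonal matrices *)

Lemma mem_ad_eigenspace (H X : 'M[C]_N) c :
  X \in ad_eigenspace H c <-> ad H X = c *: X /\ X \in sl R N.
Proof.
have -> : (X \in ad_eigenspace H c) = (ad H X == c *: X) && (X \in sl R N).
  rewrite [LHS]memv_cap; congr andb.
  by rewrite [LHS]memv_ker add_lfunE opp_lfunE scale_lfunE id_lfunE subr_eq0.
by split=> [/andP[/eqP]|[/eqP -> ->]].
Qed.

Lemma ad_eigenspace_entry (d : 'rV[C]_N) c (X : 'M[C]_N) i j :
  X \in ad_eigenspace (diag_mx d) c -> X i j != 0 -> c = d 0 i - d 0 j.
Proof.
move=> /mem_ad_eigenspace[/matrixP/(_ i j)]; rewrite ad_diag mxE.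
by move=> /[swap] _ /[swap] Xij /(mulIf Xij).
Qed.

Lemma ad_eigenspace_delta (d : 'rV[C]_N) (c : C) (i j : 'I_N) : i != j ->
  c *: delta_mx i j \in ad_eigenspace (diag_mx d) (d 0 i - d 0 j).
Proof.
move=> ij; apply/mem_ad_eigenspace; split.
  apply/matrixP => k l; rewrite ad_diag !mxE.
  by case: (k =P i) => [->|_]; case: (l =P j) => [->|_] //=; rewrite ?mulr0.
by have [] := root_space_delta c ij.
Qed.

Lemma ad_eigenspace_diag (d e : 'rV[C]_N) : \sum_i e 0 i = 0 ->
  diag_mx e \in ad_eigenspace (diag_mx d) 0.
Proof.
move=> e0; apply/mem_ad_eigenspace; split.
  by rewrite adE diag_mxC subrr scale0r.
by rewrite mem_sl mxtrace_diag e0.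
Qed.

Lemma parabolic_of_diag (d : 'rV[C]_N) :
  parabolic_of (diag_mx d) =
  [set X | X \in sl R N /\ forall i j, X i j != 0 -> d 0 j <= d 0 i].
Proof.
apply/seteqP; split=> X /=.
  move: X; apply: nspan_pattern => X [c c0] /= Xc.
  split=> [|i j Xij]; first by have [] := (mem_ad_eigenspace _ _ _).1 Xc.
  by rewrite -subr_ge0 -(ad_eigenspace_entry Xc Xij).
move=> [Xsl Xd]; apply: nspan_entries => [|i j ij Xij].
  exists 0 => /=; first exact: lexx.
  by apply: ad_eigenspace_diag; apply: diag_part_sum.
exists (d 0 i - d 0 j) => /=; first by rewrite subr_ge0 Xd.
exact: ad_eigenspace_delta.
Qed.

Lemma hyperbolic_diag (d : 'rV[C]_N) : \sum_i d 0 i = 0 ->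
  (forall i, d 0 i \is Num.real) -> hyperbolic (diag_mx d).
Proof.
move=> d0 dR; split; first by rewrite mem_sl mxtrace_diag d0.
  apply/seteqP; split=> X /=.
    move: X; apply: nspan_min; [exact: mem0v|exact: rpredD|].
    by move=> X [c _] /= /mem_ad_eigenspace[].
  move=> Xsl; apply: nspan_entries => [|i j ij Xij].
    by exists 0 => //=; apply: ad_eigenspace_diag; apply: diag_part_sum.
  by exists (d 0 i - d 0 j) => //=; apply: ad_eigenspace_delta.
move=> c; rewrite -subv0 => /subvPn[X Xc]; rewrite memv0 => X0.
have /matrix0Pn[i [j Xij]] := X0.
by rewrite (ad_eigenspace_entry Xc Xij) realB.
Qed.

(** The positive roots are nonnegative on the ladder, and the ones it kills are
    exactly those spanned by [Pi]; hence the standard parabolic consists of the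
    root spaces on which the ladder is nonnegative. *)
Lemma standard_parabolic_ladder (Pi : set (weight R N)) (c : nat -> bool) :
  Pi `<=` simple_roots R N ->
  (forall k, (0 < k < N)%N -> c (N - k)%N = c k) ->
  (forall k, (k.+1 < N)%N -> c k.+1 = false <-> Pi (alpha k.+1 - alpha k.+2)) ->
  standard_parabolic Pi = parabolic_of (diag_mx (ladder c)).
Proof.
move=> PiS c_sym cPi; rewrite parabolic_of_diag.
pose H := ladder_cartan c.
have posH b : positive_roots R N b -> 0 <= b H.
  move=> [_]; apply: nspan_ge0 => a /simple_rootP[i iN ->].
  by rewrite simple_root_ladder // mulrn_wge0.
have PiH b : nspan Pi b -> b H = 0.
  apply: nspan_eq0 => a Pia; have /simple_rootP[i iN aE] := PiS _ Pia.
  move: Pia; rewrite aE simple_root_ladder // => /(cPi _ iN) ->.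
  exact: mul0rn.
apply/seteqP; split=> X /=.
  move: X; apply: nspan_pattern => X XP; split=> [|i j Xij].
    case: XP => [[/=|[b _ []//]]|[b _ []//]].
    by rewrite mem_cartan mem_sl => /andP[].
  rewrite -subr_ge0; case: XP => [[/= XH|[b bP bX]]|[b [bPi _] bX]].
  - move: XH Xij; rewrite mem_cartan => /andP[_ /is_diag_mxP Xd].
    have [->|/Xd ->] := eqVneq i j; first by rewrite subrr.
    by rewrite eqxx.
  - by rewrite -alphaB_ladder // -(root_space_entry bX Xij) posH.
  - rewrite -alphaB_ladder // -(root_space_entry bX Xij) opp_lfunE.
    by rewrite PiH ?oppr0.
move=> [Xsl Xd]; apply: nspan_entries => [|i j ij Xij].
  left; left => /=; rewrite mem_cartan diag_mx_is_diag andbT mxtrace_diag.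
  by apply/eqP/diag_part_sum.
have [lt_ij|lt_ji|/val_inj/eqP] := ltngtP i j; last by rewrite (negPf ij).
  left; right; exists (alpha i.+1 - alpha j.+1); first exact: positive_root_alpha.
  exact: root_space_delta.
right; exists (alpha j.+1 - alpha i.+1); last first.
  by rewrite opprB; apply: root_space_delta.
split; last exact: positive_root_alpha.
apply: nspan_alpha (ltnW lt_ji) _ => k /andP[jk ki].
(* A nonincreasing sequence with equal values at j < i is constant between
   them, so every simple root used to get from j to i is in Pi. *)
have kN : (k.+1 < N)%N by exact: leq_ltn_trans ki _.
apply/cPi => //; apply: (ladder_eq (ltnW lt_ji) (Xd _ _ Xij)).
by rewrite ltnS jk.
Qed.

End Roots.
(** * The involution of sl(2n) fixing the symplectic algebra *)

Section SymplecticForm.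
Variables (R : realType) (n : nat).
Local Notation C := R[i].
Local Notation D := (sp_conj_mx R n).

(** The matrix of the symplectic form preserved by [sp R n]: [D] is symmetric
    and its own inverse, so this is the standard form moved along [D]. *)
Definition sp_form : 'M[C]_(n + n) := D *m block_mx 0 1%:M (- 1%:M) 0 *m D.

Lemma sp_formK : sp_form *m sp_form = - 1%:M.
Proof.
rewrite /sp_form; set J := block_mx 0 1%:M _ _.
have -> : D *m J *m D *m (D *m J *m D) = D *m (J *m J) *m D.
  by rewrite !mulmxA -(mulmxA _ D D) sp_conj_mxK mulmx1.
have -> : J *m J = - 1%:M.
  rewrite /J mulmx_block scalar_mx_block opp_block_mx.
  by rewrite !(mul0mx, mulmx0, mul1mx, mulmx1, mulNmx, add0r, addr0, oppr0).
by rewrite mulmxN mulmx1 mulNmx sp_conj_mxK.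
Qed.

(** As the inverse of [sp_form] is its opposite, this is minus the adjoint with
    respect to the symplectic form. *)
Definition sp_invol (X : 'M[C]_(n + n)) : 'M[C]_(n + n) :=
  sp_form *m X^T *m sp_form.

Lemma sp_conj_mx_sym : D^T = D.
Proof.
have [d [_ ->]] := sp_conj_mxE R n.
rewrite tr_block_mx !trmx0 tr_diag_mx; congr block_mx.
apply/matrixP => i j; rewrite !mxE; congr (_%:R); congr nat_of_bool.
by rewrite -(inj_eq rev_ord_inj) rev_ordK eq_sym.
Qed.

Lemma sp_invol_fix X : sp R n X -> sp_invol X = X.
Proof.
case=> _ [A [B [A' [BT AT' ->]]]] <-.
rewrite invmx_sp_conj_mx /sp_invol /sp_form !trmx_mul sp_conj_mx_sym.
set M := block_mx A B A' _; set J := block_mx 0 _ _ 0.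
have DX Y : D *m (D *m Y) = Y :> 'M_(n + n) by rewrite mulmxA sp_conj_mxK mul1mx.
rewrite -!mulmxA !DX; congr (_ *m _); rewrite !mulmxA; congr (_ *m _).
rewrite /M /J tr_block_mx BT AT' linearN /= trmxK !mulmx_block.
by rewrite !(mul0mx, mulmx0, mul1mx, mulmx1, mulNmx, mulmxN, add0r, addr0, opprK).
Qed.

Lemma sp_invol_ad H X : sp_invol (ad H X) = ad (sp_invol H) (sp_invol X).
Proof.
have mulE Y Z : sp_invol Y *m sp_invol Z = - sp_invol (Z *m Y).
  rewrite /sp_invol trmx_mul; move: sp_form sp_formK => W WK.
  rewrite !mulmxA -(mulmxA _ W W) WK.
  by rewrite mulmxN mulmx1 !mulNmx.
by rewrite !adE !mulE opprK [RHS]addrC /sp_invol linearB /= mulmxBr mulmxBl.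
Qed.

Lemma sp_invol_sl X : X \in sl R (n + n) -> sp_invol X \in sl R (n + n).
Proof.
rewrite !mem_sl => /eqP trX; rewrite mxtrace_mulC mulmxA sp_formK mulNmx mul1mx.
by rewrite linearN /= mxtrace_tr trX oppr0.
Qed.

(** As the involution fixes [H] and respects brackets, it preserves each
    eigenspace of [ad H]. *)
Lemma parabolic_of_invol H X : sp R n H ->
  parabolic_of H X -> parabolic_of H (sp_invol X).
Proof.
move=> spH; move: X; apply: nspan_min.
- by rewrite /sp_invol trmx0 mulmx0 mul0mx; apply: nspan0.
- move=> X Y; rewrite /sp_invol linearD /= mulmxDr mulmxDl; exact: nspanD.
move=> X [c c0] /= /mem_ad_eigenspace[adX Xsl]; apply: nspan_gen.
exists c => //=; apply/mem_ad_eigenspace; split; last exact: sp_invol_sl.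
rewrite -{1}(sp_invol_fix spH) -sp_invol_ad adX /sp_invol.
by rewrite linearZ /= -scalemxAr -scalemxAl.
Qed.

Lemma rev_lshift (i : 'I_n) : rev_ord (lshift n i) = rshift n (rev_ord i).
Proof. by apply: val_inj; rewrite /= addnBA. Qed.

Lemma rev_rshift (i : 'I_n) : rev_ord (rshift n i) = lshift n (rev_ord i).
Proof. by apply: rev_ord_inj; rewrite rev_lshift !rev_ordK. Qed.

Lemma sp_form_monomial : exists2 w : 'I_(n + n) -> C,
  forall i, w i != 0 & forall i j, sp_form i j = w i *+ (j == rev_ord i).
Proof.
have [w formE] : exists w : 'I_(n + n) -> C,
    forall i j, sp_form i j = w i *+ (j == rev_ord i).
  have [d [_ DE]] := sp_conj_mxE R n.
  exists (row_mx d (- \row_i d 0 (rev_ord i)) 0) => i j.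
  rewrite /sp_form DE !mulmx_block.
  rewrite !(mul0mx, mulmx0, mul1mx, mulmx1, mulNmx, mulmxN, add0r, addr0, oppr0).
  rewrite -(splitK i) -(splitK j); case: (split i) => k; case: (split j) => l;
    rewrite /= ?rev_lshift ?rev_rshift ?row_mxEl ?row_mxEr.
  - by rewrite block_mxEul mxE eq_lrshift mulr0n.
  - rewrite block_mxEur mul_diag_mx !mxE (inj_eq (@rshift_inj _ _)).
    by rewrite mulr_natr.
  - rewrite block_mxEdl mul_mx_diag !mxE (inj_eq (@lshift_inj _ _)).
    by case: eqP => [->|_]; rewrite ?mul1r // mul0r oppr0.
  - by rewrite block_mxEdr mxE eq_rlshift mulr0n.
exists w => // i.
(* The (i, i) entry of the square is w i * w (rev i) = -1. *)
have /matrixP/(_ i i) := sp_formK; rewrite !mxE eqxx (bigD1 (rev_ord i)) //=.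
rewrite big1 ?addr0; last by move=> k /negPf ki; rewrite !formE ki mulr0n mul0r.
rewrite !formE rev_ordK !eqxx !mulr1n => ww; apply: contra_eq_neq ww => ->.
by rewrite mul0r eq_sym oppr_eq0 oner_eq0.
Qed.

Lemma sp_invol_entry (X : 'M[C]_(n + n)) i j :
  X i j != 0 -> sp_invol X (rev_ord j) (rev_ord i) != 0.
Proof.
have [w w0 formE] := sp_form_monomial => Xij.
rewrite /sp_invol mxE (bigD1 i) //= big1 ?addr0; last first.
  by move=> k ki; rewrite formE (inj_eq rev_ord_inj) eq_sym (negPf ki) mulr0.
rewrite mxE (bigD1 j) //= big1 ?addr0; last first.
  by move=> k ki; rewrite formE rev_ordK (negPf ki) mulr0n mul0r.
by rewrite !formE rev_ordK !eqxx !mulr1n mxE !mulf_neq0.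
Qed.

End SymplecticForm.

(** * Compatibility and symmetry *)

Lemma compatible_symmetric (R : realType) (n : nat)
    (Pi : set (weight R (n + n))) : Pi `<=` simple_roots R (n + n) ->
  compatible (sp R n) (standard_parabolic Pi) ->
  forall k, (0 < k < n + n)%N ->
    Pi (alpha R _ (n + n - k) - alpha R _ (n + n - k).+1) <->
    Pi (alpha R _ k - alpha R _ k.+1).
Proof.
move=> PiS [H [spH _ pE]].
have sym k : (0 < k < n + n)%N -> Pi (alpha R _ k - alpha R _ k.+1) ->
    Pi (alpha R _ (n + n - k) - alpha R _ (n + n - k).+1).
  case: k => [//|i] /= iN Pik.
  pose i0 := Ordinal (ltnW iN); pose j0 := Ordinal iN.
  have [X pX Xji] := (standard_parabolic_simple PiS (erefl : j0 = i0.+1 :> nat)).1 Pik.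
  have jE : rev_ord i0 = (rev_ord j0).+1 :> nat by rewrite /= subnSK.
  have -> : (n + n - i.+1 = (rev_ord j0).+1)%N by rewrite -jE.
  rewrite -{2}jE; apply/(standard_parabolic_simple PiS jE).
  exists (sp_invol X); last exact: sp_invol_entry.
  by move: pX; rewrite pE; apply: parabolic_of_invol.
move=> k /andP[k0 kN]; split; last by apply: sym; rewrite k0.
have := sym (n + n - k)%N; rewrite subKn ?(ltnW kN) //; apply.
by rewrite subn_gt0 kN /= ltn_subrL k0 (ltn_trans k0).
Qed.

(** The diagonal matrix of the ladder that jumps at the simple roots outside
    [Pi] is the required element of [sp R n]. *)
Lemma symmetric_compatible (R : realType) (n : nat)
    (Pi : set (weight R (n + n))) : Pi `<=` simple_roots R (n + n) ->
  (forall k, (0 < k < n + n)%N ->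
    Pi (alpha R _ (n + n - k) - alpha R _ (n + n - k).+1) <->
    Pi (alpha R _ k - alpha R _ k.+1)) ->
  compatible (sp R n) (standard_parabolic Pi).
Proof.
move=> PiS Pi_sym.
pose c k := ~~ `[< Pi (alpha R (n + n) k - alpha R (n + n) k.+1) >].
have c_sym k : (0 < k < n + n)%N -> c (n + n - k)%N = c k.
  by move=> /Pi_sym Pik; rewrite /c; congr (~~ _); apply: asbool_equiv_eq.
exists (diag_mx (ladder R (n + n) c)); split.
- suff : sp_cartan R n (diag_mx (ladder R (n + n) c)) by rewrite -sp_diagE => -[].
  exists (lsubmx (ladder R (n + n) c)); congr diag_mx.
  rewrite -{1}[ladder R _ c]hsubmxK; congr row_mx; apply/rowP => i.
  rewrite [LHS]mxE [RHS]mxE [X in - X]mxE [X in - X]mxE -rev_rshift.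
  by rewrite ladder_rev // opprK.
- by apply: hyperbolic_diag; [exact: ladder_sum|exact: ladder_real].
apply: standard_parabolic_ladder => // k _; rewrite /c.
by split=> [/negbFE/asboolP|/asboolP ->].
Qed.

Theorem proposition9 (R : realType) (n : nat) (n_ge1 : (1 <= n)%N)
    (Pi : set (weight R (n + n))) (Pi_simple : Pi `<=` simple_roots R (n + n)) :
  let a := alpha R (n + n) in
  compatible (sp R n) (standard_parabolic Pi) <->
  (forall k : nat, (1 <= k <= n - 1)%N ->
     let E := [set a k - a k.+1; a (2 * n - k)%N - a (2 * n + 1 - k)%N] in
     E `<=` Pi \/ E `&` Pi = set0).
Proof.
move=> a; have idx k : (k < n)%N ->
    ((2 * n - k = n + n - k)%N * (2 * n + 1 - k = (n + n - k).+1)%N)%type.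
  by move=> kn; rewrite addn1 mul2n -addnn subSn // ltnW // ltn_addr.
split=> [comp k /andP[k0]|cond].
  rewrite -ltnS subn1 prednK // => kn; rewrite !idx // => E.
  have sym : Pi (a (n + n - k)%N - a (n + n - k).+1) <-> Pi (a k - a k.+1).
    by apply: compatible_symmetric => //; rewrite k0 ltn_addr.
  have [Pik|nPik] := pselect (Pi (a k - a k.+1)).
    by left=> _ [] -> //; apply/sym.
  by right; apply/seteqP; split=> // _ [[] -> // /sym].
apply: symmetric_compatible => // k.
(* The indices below n suffice: k |-> 2n - k exchanges the two halves and
   fixes n. *)
have half l : (0 < l < n)%N ->
    Pi (a (n + n - l)%N - a (n + n - l).+1) <-> Pi (a l - a l.+1).
  move=> /andP[l0 ln]; have := cond l.
  rewrite l0 -ltnS subn1 prednK // ln !idx // => /(_ isT) /=.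
  move=> -[EPi|/seteqP[EPi _]]; split=> PiE.
  - by apply: EPi; left.
  - by apply: EPi; right.
  - by case: (EPi (a (n + n - l)%N - a (n + n - l).+1)); split=> //; right.
  - by case: (EPi (a l - a l.+1)); split=> //; left.
move=> /andP[k0 kN]; have [kn|nk|->] := ltngtP k n; last by rewrite addnK.
  by apply: half; rewrite k0.
have := half (n + n - k)%N; rewrite subKn ?(ltnW kN) // => half_k.
by apply: iff_sym; apply: half_k; rewrite subn_gt0 kN ltn_subLR ?ltn_add2r // ltnW.
Qed.
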